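(* For every integer $N\ge 0$, \[\zeta\left(3,\{2\}^N\right)=2\left[\sum_{j=1}^{N}\frac{(-1)^{j+1}(2j)\,\pi^{2N+2-2j}}{(2N+3-2j)!}\,\eta(2j+1)-(-1)^N\left[1-\left(1-2^{-2N-2}\right)(2N+2)\right]\zeta(2N+3)\right].\]
   Context: Multiple zeta values: for positive integers $i_1\ge2,i_2,\dots,i_k$, $\zeta(i_1,\dots,i_k)=\sum_{n_1>n_2>\cdots>n_k\ge1}\frac{1}{n_1^{i_1}\cdots n_k^{i_k}}$. $\zeta(3,\{2\}^N)$ denotes $\zeta(3,2,\dots,2)$ with $N$ entries equal to $2$. $\eta(m)=(1-2^{1-m})\zeta(m)$ is the Dirichlet eta function. *)

(* Defs.v *)
From HB Require Import structures.
From mathcomp Require Import all_boot all_order all_algebra.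
From mathcomp Require Import all_classical all_reals all_analysis.

Set Implicit Arguments.
Unset Strict Implicit.
Unset Printing Implicit Defensive.

Import Order.TTheory GRing.Theory Num.Theory.

Local Open Scope classical_set_scope.
Local Open Scope ring_scope.

(* The sequences n = [:: n_1; ...; n_k] with n_1 > n_2 > ... > n_k >= 1. *)
Definition mzv_dom (k : nat) : set (seq nat) :=
  [set n | [/\ size n = k, sorted gtn n & all (leq 1) n]].

(* zeta(i_1, ..., i_k) for s = [:: i_1; ...; i_k]. All terms are nonnegative,
   so the sum is taken in the extended reals, where it always exists; it is
   finite for positive i_1, ..., i_k with i_1 >= 2. *)
Definition mzv (R : realType) (s : seq nat) : \bar R :=
  \esum_(n in mzv_dom (size s))
    (\prod_(p <- zip n s) (p.1%:R ^+ p.2)^-1)%:E.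

(* Riemann zeta value at an integer m >= 2, as a real number; [fine] sends an
   infinite sum to 0, which happens only for m <= 1. *)
Definition riemann_zeta (R : realType) (m : nat) : R := fine (mzv R [:: m]).

Definition dirichlet_eta (R : realType) (m : nat) : R :=
  (1 - 2%:R ^ (1 - m%:Z)) * riemann_zeta R m.

(* Main.v *)
(** With [y = x^2] and [P_M = prod_(k <= M) (1 - y/k^2)], the number
    [zeta(3, {2}^N)] is up to sign the coefficient of [y^N] in
    [sum_(n >= 1) P_(n-1) / n^3].  Put [c_k = 'C(2M, M+k) / 'C(2M, M)] and let
    [H_n] be the harmonic numbers.  The finite identity
      [sum_(n <= M) P_(n-1)/n^3 + 2 sum_(n <= M) 1/(n (n^2 - y))
       = 4 P_M sum_(k <= M) (-1)^(k-1) c_k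
           (k/(k^2 - y)^2 + (H_(M+k) - H_M)/(k^2 - y))]
    holds by induction on [M]: the increment is controlled by the partial
    fraction expansion of [1/P_M] and by
    [sum_k (-1)^(k-1) c_k (H_(M+k) - H_M) = 1/(4M)].  Let [M] tend to infinity
    in each coefficient: [c_k] tends to [1], the harmonic correction is
    [O(log M / M)] and drops out, and [P_M] tends to [sin (pi x) / (pi x)].
    The last limit is obtained coefficientwise from the factorization of
    [sin ((2M+1) t) / sin t] as a polynomial in [sin t ^+ 2], since
    [sin (k pi / (2M+1))^-2] differs from [((2M+1) / (k pi))^2] by at most [1]. *)

Require Import Defs.
From HB Require Import structures.
From mathcomp Require Import all_boot all_order all_algebra.
From mathcomp Require Import all_classical all_reals all_analysis.
From mathcomp Require Import ring lra zify.

Set Implicit Arguments.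
Unset Strict Implicit.
Unset Printing Implicit Defensive.

Import Order.TTheory GRing.Theory Num.Theory.
Import numFieldNormedType.Exports.

Local Open Scope classical_set_scope.
Local Open Scope ring_scope.

(** * Power series acted on by products of linear factors *)

(** The coefficient of ['X^m] is the elementary symmetric function [e_m] of [a 0, ..., a (M-1)]. For
    [a k = 1/(k+1)^2] it is the sum for [zeta({2}^m)] truncated at [M]. *)
Definition linprod (R : comNzRingType) (a : nat -> R) (M : nat) : {poly R} :=
  \prod_(k < M) (1 + a k *: 'X).

Lemma linprodS (R : comNzRingType) (a : nat -> R) M :
  linprod a M.+1 = linprod a M * (1 + a M *: 'X).
Proof. by rewrite /linprod big_ord_recr. Qed.

Lemma coef_linprodS (R : comNzRingType) (a : nat -> R) M m :
  (linprod a M.+1)`_m =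
  (linprod a M)`_m + a M * (if m is i.+1 then (linprod a M)`_i else 0).
Proof.
rewrite linprodS mulrDr mulr1 coefD -scalerAr coefZ coefMX.
by case: m.
Qed.

Lemma coef0_linprod (R : comNzRingType) (a : nat -> R) M : (linprod a M)`_0 = 1.
Proof.
elim: M => [|M IH]; first by rewrite /linprod big_ord0 coef1.
by rewrite coef_linprodS IH mulr0 addr0.
Qed.

Lemma coef_linprod0 (R : comNzRingType) (a : nat -> R) m :
  (linprod a 0)`_m = (m == 0)%:R.
Proof. by rewrite /linprod big_ord0 coef1. Qed.

Lemma coef_linprodN (R : comNzRingType) (a : nat -> R) M m :
  (linprod (fun k => - a k) M)`_m = (-1) ^+ m * (linprod a M)`_m.
Proof.
elim: M m => [|M IH] m.
  by rewrite !coef_linprod0; case: m => [|m]; rewrite ?mulr0 ?mulr1.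
rewrite !coef_linprodS !IH; case: m => [|m]; first by rewrite !mulr0 !addr0.
by rewrite IH exprS; ring.
Qed.

Lemma coef_linprodZ (R : comNzRingType) (c : R) (a : nat -> R) M m :
  (linprod (fun k => c * a k) M)`_m = c ^+ m * (linprod a M)`_m.
Proof.
elim: M m => [|M IH] m.
  by rewrite !coef_linprod0; case: m => [|m]; rewrite ?mulr0 ?mulr1.
rewrite !coef_linprodS !IH; case: m => [|m]; first by rewrite !mulr0 !addr0.
by rewrite IH exprS; ring.
Qed.

Lemma coef_linprod_ge0 (R : realDomainType) (a : nat -> R) M m :
  (forall k, (k < M)%N -> 0 <= a k) -> 0 <= (linprod a M)`_m.
Proof.
elim: M m => [|M IH] m a0; first by rewrite coef_linprod0 ler0n.
have a0' k : (k < M)%N -> 0 <= a k by move=> kM; exact/a0/ltnW.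
rewrite coef_linprodS addr_ge0 ?IH// mulr_ge0 ?a0//.
by case: m => // m; exact: IH.
Qed.

(* The power series with coefficients [a], multiplied by the polynomial [p]. *)
Definition act (R : comNzRingType) (p : {poly R}) (a : nat -> R) (N : nat) : R :=
  \sum_(m < N.+1) p`_m * a (N - m)%N.

Lemma coefM_poly_act (R : comNzRingType) (p : {poly R}) (a : nat -> R) N i :
  (i <= N)%N -> (p * \poly_(j < N.+1) a j)`_i = act p a i.
Proof.
move=> iN; rewrite coefM; apply: eq_bigr => m _; rewrite coef_poly.
by rewrite ltnS (leq_trans (leq_subr _ _) iN).
Qed.

Lemma eq_act (R : comNzRingType) (p : {poly R}) (a b : nat -> R) N :
  a =1 b -> act p a N = act p b N.
Proof. by move=> ab; apply: eq_bigr => m _; rewrite ab. Qed.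

Lemma actM (R : comNzRingType) (p q : {poly R}) (a : nat -> R) N :
  act (p * q) a N = act p (act q a) N.
Proof.
rewrite -(@coefM_poly_act _ _ _ N)// -mulrA coefM; apply: eq_bigr => m _.
by rewrite coefM_poly_act ?leq_subr.
Qed.

Lemma actD (R : comNzRingType) (p : {poly R}) (a b : nat -> R) N :
  act p (fun j => a j + b j) N = act p a N + act p b N.
Proof. by rewrite -big_split/=; apply: eq_bigr => m _; rewrite mulrDr. Qed.

Lemma actZ (R : comNzRingType) (p : {poly R}) c (a : nat -> R) N :
  act p (fun j => c * a j) N = c * act p a N.
Proof. by rewrite big_distrr/=; apply: eq_bigr => m _; rewrite mulrCA. Qed.

Lemma act1 (R : comNzRingType) (a : nat -> R) N : act 1 a N = a N.
Proof.
rewrite /act big_ord_recl/= coef1 mul1r subn0 big1 ?addr0// => i _.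
by rewrite coef1 mul0r.
Qed.

Lemma act_delta (R : comNzRingType) (p : {poly R}) N :
  act p (fun j => (j == 0)%:R) N = p`_N.
Proof.
rewrite /act big_ord_recr/= subnn mulr1 big1 ?add0r// => i _.
by rewrite subn_eq0 leqNgt ltn_ord mulr0.
Qed.

Lemma act_lin (R : comNzRingType) (c : R) (a : nat -> R) N :
  act (1 + c *: 'X) a N = a N + c * (if N is j.+1 then a j else 0).
Proof.
rewrite /act big_ord_recl/= subn0 coefD coef1 coefZ coefX mulr0 addr0 mul1r.
congr (_ + _); case: N => [|N]; first by rewrite big_ord0 mulr0.
rewrite big_ord_recl/= big1 ?addr0; last first.
  by move=> i _; rewrite coefD coef1 coefZ coefX !mulr0 addr0 mul0r.
by rewrite coefD coef1 coefZ coefX mulr1 add0r subSS subn0.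
Qed.

(** Since [1 + c X] is invertible as a power series, an identity may be checked after multiplying by
    it. *)
Lemma act_lin_inj (R : comNzRingType) (c : R) (a b : nat -> R) :
  act (1 + c *: 'X) a =1 act (1 + c *: 'X) b -> a =1 b.
Proof.
move=> ab; elim=> [|N IH]; first by have := ab 0; rewrite !act_lin !mulr0 !addr0.
by have := ab N.+1; rewrite !act_lin IH => /addIr.
Qed.

(** * The finite identity *)

(* ['C(2M, M + k) / 'C(2M, M)]; the product vanishes for [k > M]. *)
Definition binratio (R : realFieldType) (M k : nat) : R :=
  \prod_(i < k) ((M%:R - i%:R) / (M%:R + i%:R + 1)).

(* [H_(M + k) - H_M] for the harmonic numbers [H_n]. *)
Definition harmdiff (R : realFieldType) (M k : nat) : R :=
  \sum_(i < k) (M%:R + i%:R + 1)^-1.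

Lemma binratioS (R : realFieldType) M k :
  binratio R M k.+1 * (M%:R + k%:R + 1) = binratio R M k * (M%:R - k%:R).
Proof.
have H : M%:R + k%:R + 1 != 0 :> R by rewrite -natrD natr1 pnatr_eq0.
by rewrite /binratio big_ord_recr/= -mulrA divfK.
Qed.

Lemma binratio_gt (R : realFieldType) M : binratio R M M.+1 = 0.
Proof. by rewrite /binratio big_ord_recr/= subrr mul0r mulr0. Qed.

Lemma binratio0 (R : realFieldType) M : binratio R M 0 = 1.
Proof. by rewrite /binratio big_ord0. Qed.

(** This is [c_(M+1,k) (1 - k^2/(M+1)^2) = c_(M,k)] cleared of denominators, so that it also covers
    [k = M+1], where both sides vanish. *)
Lemma binratio_recl (R : realFieldType) M k :
  binratio R M.+1 k * (M.+1%:R ^+ 2 - k%:R ^+ 2) = M.+1%:R ^+ 2 * binratio R M k.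
Proof.
elim: k => [|k IH]; first by rewrite !binratio0; ring.
have x0 : 0 <= M%:R + k%:R :> R by rewrite addr_ge0.
have n1 : M%:R + k%:R + 1 != 0 :> R by apply: lt0r_neq0; lra.
apply: (mulIf n1); rewrite -[RHS]mulrA binratioS mulrA -IH.
have := binratioS R M.+1 k; rewrite -!natr1 => E.
transitivity (binratio R M.+1 k.+1 * (M%:R + 1 + k%:R + 1) *
   (M%:R - k%:R) * (M%:R + k%:R + 1)); first by ring.
by rewrite E; ring.
Qed.

Lemma telescope_rev (V : zmodType) (f : nat -> V) M :
  \sum_(1 <= k < M.+1) (f k - f k.+1) = f 1%N - f M.+1.
Proof.
rewrite -[RHS]opprB -(telescope_sumr f)// -sumrN.
by apply: eq_bigr => k _; rewrite opprB.
Qed.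

(** [(-1)^(k-1) c_k], with [k+1] in the exponent to avoid truncated subtraction. For [M > 0],
    [1/P_M] is the sum of [2 bsign_k / (1 - y/k^2)]. *)
Definition bsign (R : realFieldType) M k : R := (-1) ^+ k.+1 * binratio R M k.

Lemma bsignS (R : realFieldType) M k :
  bsign R M k.+1 * (M%:R + k%:R + 1) = - bsign R M k * (M%:R - k%:R).
Proof. by rewrite /bsign -mulrA binratioS exprS; ring. Qed.

Lemma sum_bsign (R : realFieldType) M : (0 < M)%N ->
  \sum_(1 <= k < M.+1) bsign R M k = 2^-1.
Proof.
move=> M0; have n1 : M%:R != 0 :> R by rewrite pnatr_eq0 -lt0n.
(* An antidifference: by [bsignS], [f k - f k.+1] is [bsign k] times
   [((M+k) + (M-k)) / (2M) = 1]. *)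
pose f k : R := bsign R M k * (M%:R + k%:R) / (2 * M%:R).
have b1 : bsign R M 1 * (M%:R + 1) = M%:R.
  by have := bsignS R M 0; rewrite /bsign binratio0 addr0 => ->; ring.
rewrite -[RHS](_ : f 1%N - f M.+1 = _); last first.
  by rewrite /f b1 /bsign binratio_gt; field.
rewrite -telescope_rev; apply: eq_bigr => k _; rewrite /f -[k.+1%:R]natr1 addrA bsignS.
by field.
Qed.

Lemma harmdiffS (R : realFieldType) M k :
  harmdiff R M k.+1 = harmdiff R M k + (M%:R + k%:R + 1)^-1.
Proof. by rewrite /harmdiff big_ord_recr. Qed.

Lemma sum_bsign_harmdiff (R : realFieldType) M : (0 < M)%N ->
  \sum_(1 <= k < M.+1) bsign R M k * harmdiff R M k = (4 * M%:R)^-1.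
Proof.
move=> M0; have n1 : M%:R != 0 :> R by rewrite pnatr_eq0 -lt0n.
(* The previous antidifference, adjusted by summation by parts. The index [k.-1] makes the harmonic
   part vanish at [k = 1], leaving [1/(4M)]. *)
pose f k : R := bsign R M k * (M%:R + k%:R) *
  (2 * M%:R * harmdiff R M k.-1 + 1) / (4 * M%:R ^+ 2).
have b1 : bsign R M 1 * (M%:R + 1) = M%:R.
  by have := bsignS R M 0; rewrite /bsign binratio0 addr0 => ->; ring.
rewrite -[RHS](_ : f 1%N - f M.+1 = _); last first.
  by rewrite /f b1 /bsign binratio_gt /harmdiff big_ord0; field.
rewrite -telescope_rev; apply: eq_big_nat => -[//|k] _.
have x0 : 0 <= M%:R + k%:R :> R by rewrite addr_ge0.
have n2 : M%:R + k%:R + 1 != 0 :> R by apply: lt0r_neq0; lra.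
rewrite /f -[k.+2%:R]natr1 addrA bsignS /= harmdiffS -[k.+1%:R]natr1.
by field; rewrite n1 n2.
Qed.

Lemma harmdiff_recl (R : realFieldType) M k :
  harmdiff R M.+1 k = harmdiff R M k + (M.+1%:R + k%:R)^-1 - M.+1%:R^-1.
Proof.
elim: k => [|k IH]; first by rewrite /harmdiff !big_ord0 addr0 add0r subrr.
rewrite !harmdiffS IH -[k.+1%:R]natr1 -[M.+1%:R]natr1.
by rewrite -!addrA [1 + k%:R]addrC; ring.
Qed.

Definition sinprod (R : realFieldType) (M : nat) : {poly R} :=
  linprod (fun k => - k.+1%:R ^- 2) M.

(* The power series of [1 / sinprod R M], from its partial fractions. *)
Definition invsinprod (R : realFieldType) (M j : nat) : R :=
  if j is 0 then 1 else
  \sum_(1 <= k < M.+1) 2 * bsign R M k * (k%:R ^- 2) ^+ j.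

(* The power series in [y] of
   [sum_k (-1)^(k-1) c_k (k/(k^2 - y)^2 + (H_(M+k) - H_M)/(k^2 - y))]. *)
Definition oddsum (R : realFieldType) (M j : nat) : R :=
  \sum_(1 <= k < M.+1) bsign R M k * (k%:R ^- 2) ^+ j *
     (j.+1%:R * k%:R ^- 3 + harmdiff R M k * k%:R ^- 2).

Lemma bsign_gt (R : realFieldType) M : bsign R M M.+1 = 0.
Proof. by rewrite /bsign binratio_gt mulr0. Qed.

Lemma bsign_recl (R : realFieldType) M k :
  bsign R M k = bsign R M.+1 k * (M.+1%:R ^+ 2 - k%:R ^+ 2) / M.+1%:R ^+ 2.
Proof.
have n1 : M.+1%:R ^+ 2 != 0 :> R by rewrite expf_neq0 ?pnatr_eq0.
apply: (mulIf n1); rewrite divfK// /bsign -[RHS]mulrA binratio_recl.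
by rewrite -mulrA [binratio _ _ _ * _]mulrC.
Qed.

(** Multiplying [1/(1 - y/k^2)] by [1 - y/(M+1)^2] scales its coefficients of positive degree by
    [1 - k^2/(M+1)^2]. This turns the weights for [M+1] into those for [M] and removes the pole
    [k = M+1]. *)
Lemma act_lin_invsinprod (R : realFieldType) M j :
  act (1 + (- M.+1%:R ^- 2) *: 'X) (invsinprod R M.+1) j = invsinprod R M j.
Proof.
have n1 : M.+1%:R != 0 :> R by rewrite pnatr_eq0.
rewrite act_lin; case: j => [|j] /=; first by rewrite mulr0 addr0.
(* The constant term, set to 1 by definition, fits the general sum because [M+1 > 0] and the weights
   [bsign] add up to 1/2. *)
rewrite -/(invsinprod R M.+1 j) [invsinprod R M.+1 j](_ : _ =
    \sum_(1 <= k < M.+2) 2 * bsign R M.+1 k * (k%:R ^- 2) ^+ j); last first.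
  rewrite /invsinprod; case: j => [|j] //; under eq_bigr do rewrite expr0 mulr1.
  by rewrite -big_distrr/= sum_bsign// divff// pnatr_eq0.
rewrite [RHS](_ : _ = \sum_(1 <= k < M.+2) 2 * bsign R M k * (k%:R ^- 2) ^+ j.+1);
  last first.
  by rewrite [RHS]big_nat_recr//= bsign_gt mulr0 mul0r addr0.
rewrite big_distrr/= -big_split/=; apply: eq_big_nat => -[//|k] _.
have n2 : k.+1%:R != 0 :> R by rewrite pnatr_eq0.
rewrite (bsign_recl _ M) exprS; move: n1 n2 (_ ^+ j) (bsign _ _ _).
by move: (M.+1%:R) (k.+1%:R) => L x n1 n2 t b; field; rewrite n1 n2.
Qed.

Lemma act_sinprod_invsinprod (R : realFieldType) M j :
  act (sinprod R M) (invsinprod R M) j = (j == 0)%:R.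
Proof.
elim: M j => [|M IH] j.
  rewrite /sinprod /linprod big_ord0 act1; case: j => //= j.
  by rewrite big_geq.
rewrite /sinprod linprodS actM -[RHS]IH; apply: eq_act => i.
exact: act_lin_invsinprod.
Qed.

(** [P_M / P_(M+1) = 1/(1 - y/(M+1)^2)] is a geometric series. *)
Lemma act_sinprod_invsinprodS (R : realFieldType) M j :
  act (sinprod R M) (invsinprod R M.+1) j = (M.+1%:R ^- 2) ^+ j.
Proof.
move: j; apply: (@act_lin_inj _ (- M.+1%:R ^- 2)) => j.
rewrite -actM mulrC -linprodS act_sinprod_invsinprod act_lin.
by case: j => [|j]; rewrite ?mulr0 ?addr0// exprS mulNr subrr.
Qed.

(** The increment in the induction on [M]. For positive [j] both sides agree term by term in [k]. At
    [j = 0] the two corrections are summed by [sum_bsign] and [sum_bsign_harmdiff]. *)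
Lemma act_lin_oddsum (R : realFieldType) M j :
  act (1 + (- M.+1%:R ^- 2) *: 'X) (oddsum R M.+1) j =
  oddsum R M j + (M.+1%:R ^- 3 / 2 * invsinprod R M.+1 j +
                  M.+1%:R ^- 3 / 4 * (j == 0)%:R).
Proof.
have n1 : M.+1%:R != 0 :> R by rewrite pnatr_eq0.
have L0 : 0 < M.+1%:R :> R by rewrite ltr0n.
have -> : oddsum R M j = \sum_(1 <= k < M.+2) bsign R M k * (k%:R ^- 2) ^+ j *
     (j.+1%:R * k%:R ^- 3 + harmdiff R M k * k%:R ^- 2).
  by rewrite [RHS]big_nat_recr//= bsign_gt !mul0r addr0.
rewrite act_lin; case: j => [|j] /=.
  rewrite !mulr0 addr0 !mulr1.
  have -> : M.+1%:R ^- 3 / 2 = \sum_(1 <= k < M.+2) bsign R M.+1 k * M.+1%:R ^- 3.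
    by rewrite -big_distrl/= sum_bsign// mulrC.
  have -> : M.+1%:R ^- 3 / 4 = \sum_(1 <= k < M.+2)
      bsign R M.+1 k * harmdiff R M.+1 k * M.+1%:R ^- 2.
    by rewrite -big_distrl/= sum_bsign_harmdiff//; field.
  rewrite -!big_split/=; apply: eq_big_nat => -[//|k] _.
  have n2 : k.+1%:R != 0 :> R by rewrite pnatr_eq0.
  have k0 : 0 < k.+1%:R :> R by rewrite ltr0n.
  rewrite (bsign_recl _ M) harmdiff_recl !expr0.
  move: L0 k0 n1 n2 (harmdiff _ _ _) (bsign _ _ _).
  move: (M.+1%:R) (k.+1%:R) => L x L0 x0 n1 n2 h b.
  have n3 : L + x != 0 by apply: lt0r_neq0; lra.
  by field; rewrite n1 n2 n3.
rewrite mulr0 addr0 !big_distrr/= -!big_split/=; apply: eq_big_nat => -[//|k] _.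
have n2 : k.+1%:R != 0 :> R by rewrite pnatr_eq0.
have k0 : 0 < k.+1%:R :> R by rewrite ltr0n.
rewrite (bsign_recl _ M) harmdiff_recl exprS -[j.+2%:R]natr1.
move: L0 k0 n1 n2 (harmdiff _ _ _) (bsign _ _ _).
move: (M.+1%:R) (k.+1%:R) (j.+1%:R) (_ ^+ j) => L x i t L0 x0 n1 n2 h b.
have n3 : L + x != 0 by apply: lt0r_neq0; lra.
by field; rewrite n1 n2 n3.
Qed.

(* The coefficient of [y^j] in the finite identity. *)
Lemma act_sinprod_oddsum (R : realFieldType) M j :
  4 * act (sinprod R M) (oddsum R M) j =
  \sum_(n < M) (sinprod R n)`_j / n.+1%:R ^+ 3 +
  2 * \sum_(n < M) (n.+1%:R ^+ (2 * j + 3))^-1.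
Proof.
elim: M => [|M IH].
  rewrite /act !big_ord0 mulr0 addr0 big1 ?mulr0// => i _.
  by rewrite /oddsum big_geq// mulr0.
have n1 : M.+1%:R != 0 :> R by rewrite pnatr_eq0.
rewrite !big_ord_recr/= [in act _ _ _]/sinprod linprodS actM.
rewrite (eq_act _ _ (@act_lin_oddsum R M)) actD mulrDr IH actD !actZ.
(* After multiplication by [P_M], the [1/P_(M+1)] part of the increment becomes a geometric series,
   the source of [2/(n (n^2 - y))], and the constant part becomes [P_M / n^3], up to the factor
   4. *)
rewrite act_sinprod_invsinprodS act_delta exprD exprM exprVn.
move: (M.+1%:R) n1 => L n1.
have n2 : (L ^+ 2) ^+ j != 0 by rewrite !expf_neq0.
by field; rewrite n1 n2.
Qed.

(** * The product formula for the sine *)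

(** Raising one argument of [e_(m+1)] from [b k] to [a k] changes it by at most
    [(a k - b k) e_m(a)]. *)
Lemma coef_linprod_diff (R : realDomainType) (a b : nat -> R) M m :
  (forall k, (k < M)%N -> 0 <= b k <= a k) ->
  0 <= (linprod a M)`_m.+1 - (linprod b M)`_m.+1 <=
  (\sum_(k < M) (a k - b k)) * (linprod a M)`_m.
Proof.
elim: M m => [|M IH] m ab.
  by rewrite !coef_linprod0 /= big_ord0 mul0r subrr lexx.
have ab' k : (k < M)%N -> 0 <= b k <= a k by move=> kM; exact/ab/ltnW.
have /andP[bM0 bMaM] := ab M (leqnn _).
have aM0 := le_trans bM0 bMaM.
have a0 k : (k < M)%N -> 0 <= a k.
  by move=> /ab' /andP[b0 ba]; exact: le_trans b0 ba.
have C n : 0 <= (linprod a M)`_n by apply: coef_linprod_ge0.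
have D0 : 0 <= \sum_(k < M) (a k - b k).
  by apply: sumr_ge0 => k _; rewrite subr_ge0; have /andP[] := ab' k (ltn_ord k).
rewrite !coef_linprodS big_ord_recr/=.
have /andP[l1 u1] := IH m ab'.
set D := \sum_(k < M) _ in D0 u1 *.
case: m => [|m] /= in l1 u1 *.
  rewrite !coef0_linprod !mulr0 addr0 !mulr1 in l1 u1 *.
  by apply/andP; split; lra.
have /andP[l2 u2] := IH m ab'; rewrite -/D in u2.
(* With [A], [B] the coefficients for [a], [b], the difference grows by [(a M - b M) A_(m+1) + b M
   (A_(m+1) - B_(m+1))]. The products below are those needed to bound this. *)
have := mulr_ge0 bM0 l2; have := ler_wpM2l bM0 u2.
have := mulr_ge0 (_ : 0 <= a M - b M) (C m.+1); rewrite subr_ge0 => /(_ bMaM).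
have := mulr_ge0 (mulr_ge0 (_ : 0 <= a M - b M) aM0) (C m).
rewrite subr_ge0 => /(_ bMaM).
have := mulr_ge0 (_ : 0 <= a M - b M) (mulr_ge0 D0 (C m)).
rewrite subr_ge0 => /(_ bMaM).
move: l1 u1 l2 u2 (C m) (C m.+1).
move: (linprod a M)`_m.+2 (linprod b M)`_m.+2 (linprod a M)`_m.+1.
move: (linprod b M)`_m.+1 (linprod a M)`_m (a M) (b M) => b1 a0' x y a2 b2 a1.
move=> *; apply/andP; split; nra.
Qed.

Definition oddprod (R : realFieldType) (x : R) (m : nat) : R :=
  \prod_(i < m) (x ^+ 2 - (i%:R *+ 2 + 1) ^+ 2).

Lemma oddprodS (R : realFieldType) (x : R) m :
  oddprod x m.+1 = oddprod x m * (x ^+ 2 - (m%:R *+ 2 + 1) ^+ 2).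
Proof. by rewrite /oddprod big_ord_recr. Qed.

Lemma oddprodN (R : realFieldType) (x : R) m : oddprod (- x) m = oddprod x m.
Proof. by rewrite /oddprod; under eq_bigr do rewrite sqrrN. Qed.

(** [oddprod x m] is the product of [x + c] over odd [c] with [|c| < 2m]. Replacing [x] by [x + 2]
    slides this window. *)
Lemma oddprod_shift (R : realFieldType) (x : R) m :
  oddprod (x + 2) m.+1 =
  oddprod x m * (x + m%:R *+ 2 + 1) * (x + m%:R *+ 2 + 3).
Proof.
elim: m => [|m IH]; first by rewrite oddprodS /oddprod !big_ord0; ring.
by rewrite oddprodS IH [oddprod x m.+1]oddprodS -[m.+1%:R]natr1; ring.
Qed.

Lemma oddprod_shiftN (R : realFieldType) (x : R) m :
  oddprod (x - 2) m.+1 =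
  oddprod x m * (x - m%:R *+ 2 - 1) * (x - m%:R *+ 2 - 3).
Proof.
rewrite -oddprodN opprB addrC oddprod_shift oddprodN; ring.
Qed.

(* The coefficients of [sin (x * t) / sin t] in powers of [- sin t ^+ 2]. *)
Definition chebcoef (R : realFieldType) (x : R) (m : nat) : R :=
  x * oddprod x m / ((2 * m).+1)`!%:R.

(** Coefficient form of [sin((x+2)t) + sin((x-2)t) = 2 cos(2t) sin(xt)], where [2 cos(2t) = 2 + 4X]
    at [X = - sin t ^+ 2]. *)
Lemma chebcoef_rec (R : realFieldType) (x : R) m :
  chebcoef (x + 2) m =
  2 * chebcoef x m + 4 * (if m is i.+1 then chebcoef x i else 0) -
  chebcoef (x - 2) m.
Proof.
rewrite /chebcoef; case: m => [|m].
  by rewrite /oddprod !big_ord0; field.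
rewrite oddprod_shift oddprod_shiftN oddprodS.
have -> : ((2 * m.+1).+1)`!%:R =
    (m%:R *+ 2 + 3) * (m%:R *+ 2 + 2) * ((2 * m).+1)`!%:R :> R.
  rewrite (_ : (2 * m.+1).+1 = (2 * m).+3)%N; last by lia.
  rewrite !factS !natrM mulrA; congr (_ * _ * _).
    by rewrite -addn3 natrD natrM mulr_natl.
  by rewrite -addn2 natrD natrM mulr_natl.
have f0 : ((2 * m).+1)`!%:R != 0 :> R by rewrite pnatr_eq0 -lt0n fact_gt0.
have m0 : 0 <= m%:R *+ 2 :> R by rewrite mulrn_wge0.
move: (_`!%:R) (m%:R *+ 2) f0 m0 (oddprod x m) => F z F0 z0 p.
have n1 : z + 3 != 0 by apply: lt0r_neq0; lra.
have n2 : z + 2 != 0 by apply: lt0r_neq0; lra.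
by field; rewrite F0 n1 n2.
Qed.

Definition odd_of (R : realFieldType) (M : nat) : R := M%:R *+ 2 + 1.

Lemma odd_ofS (R : realFieldType) M : odd_of R M.+1 = odd_of R M + 2.
Proof. by rewrite /odd_of -[M.+1%:R]natr1; ring. Qed.

Lemma odd_of0 (R : realFieldType) : odd_of R 0 = 1.
Proof. by rewrite /odd_of mul0rn add0r. Qed.

Lemma odd_of_gt0 (R : realFieldType) M : 0 < odd_of R M.
Proof. by rewrite /odd_of ltr_wpDl// mulrn_wge0. Qed.

Definition chebpoly (R : realFieldType) (M : nat) : {poly R} :=
  \poly_(m < M.+1) chebcoef (odd_of R M) m.

(** The truncation loses nothing: for [m > M] the factor [i = M] of [oddprod] vanishes at [2M+1]. *)
Lemma coef_chebpoly (R : realFieldType) M m :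
  (chebpoly R M)`_m = chebcoef (odd_of R M) m.
Proof.
rewrite coef_poly; case: ltnP => // Mm; rewrite /chebcoef /oddprod.
by rewrite (bigD1 (Ordinal Mm))//= subrr mul0r mulr0 mul0r.
Qed.

Lemma chebpoly_rec (R : realFieldType) M :
  chebpoly R M.+2 = (2%:P + 4 *: 'X) * chebpoly R M.+1 - chebpoly R M.
Proof.
apply/polyP => m; rewrite coefB mulrDl coefD coefCM -scalerAl coefZ coefXM.
rewrite !coef_chebpoly odd_ofS chebcoef_rec odd_ofS addrK.
by case: m => [|m] //=; rewrite coef_chebpoly odd_ofS.
Qed.

Lemma sin_chebpoly (R : realType) (t : R) M :
  sin (odd_of R M * t) = sin t * (chebpoly R M).[- sin t ^+ 2].
Proof.
pose P M := sin (odd_of R M * t) = sin t * (chebpoly R M).[- sin t ^+ 2].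
suff : P M /\ P M.+1 by case.
rewrite {}/P; elim: M => [|n [IH0 IH1]].
  rewrite odd_ofS odd_of0 mul1r /chebpoly !poly_def big_ord1 !big_ord_recl.
  rewrite big_ord0 /= addr0 /chebcoef /oddprod odd_ofS odd_of0 big_ord0 big_ord1.
  rewrite /= !hornerE /= big_ord0 (_ : 1`!%:R = 1 :> R)// (_ : 3`!%:R = 6 :> R)//.
  split; first by field.
  rewrite (_ : (1 + 1 + 1) * t = t + t + t); last by ring.
  rewrite !sinD !cosD.
  have -> : (sin t * cos t + cos t * sin t) * cos t =
    sin t * (cos t ^+ 2) *+ 2 by ring.
  have -> : cos t ^+ 2 = 1 - sin t ^+ 2 by rewrite cos2sin2.
  have -> : cos t * cos t = 1 - sin t ^+ 2 by rewrite -expr2 cos2sin2.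
  by field.
split=> //; rewrite chebpoly_rec !hornerE /= mulrBr -IH0 mulrCA -IH1 !odd_ofS.
set x := odd_of R n.
have -> : (x + 2 + 2) * t = (x + 2) * t + (t + t) by ring.
have -> : x * t = (x + 2) * t - (t + t) by ring.
by rewrite sinB !(sinD _ (t + t)) !(cosD t t) -!expr2 cos2sin2; ring.
Qed.

Lemma sinpi_nat (R : realType) k : sin (k%:R * pi) = 0 :> R.
Proof.
elim: k => [|k IH]; first by rewrite mul0r sin0.
by rewrite -natr1 mulrDl mul1r sinDpi IH oppr0.
Qed.

Lemma sin_mvt (R : realType) (x : R) : 0 < x ->
  exists2 c, 0 < c < x & sin x = cos c * x.
Proof.
move=> x0.
have [|c] := MVT (f := @sin R) (df := @cos R) x0 (fun y _ => is_derive_sin y).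
  by apply: continuous_subspaceT; exact: continuous_sin.
by rewrite in_itv/= sin0 !subr0 => cx ->; exists c.
Qed.

Lemma sin_lt_id (R : realType) (x : R) : 0 < x -> sin x <= x.
Proof.
move=> x0; have [c _ ->] := sin_mvt x0.
by rewrite ler_piMl ?cos_le1// ltW.
Qed.

(** The cosine decreases on [[0, pi]], so its intermediate value in [sin x = x cos c] exceeds
    [cos x]. *)
Lemma mul_cos_le_sin (R : realType) (x : R) : 0 < x <= pi -> x * cos x <= sin x.
Proof.
move=> /andP[x0 xpi]; have [c /andP[c0 cx] ->] := sin_mvt x0.
rewrite mulrC ler_pM2r// ltW// ltr_cos// in_itv/=; apply/andP; split; lra.
Qed.

Lemma size_linprod (R : comNzRingType) (a : nat -> R) M :
  (size (linprod a M) <= M.+1)%N.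
Proof.
apply/leq_sizeP; elim: M => [|M IH] j; first by rewrite coef_linprod0; case: j.
case: j => [//|j] Mj; rewrite coef_linprodS IH ?IH ?mulr0 ?addr0//.
exact: ltnW.
Qed.

Lemma horner_linprod0 (R : comNzRingType) (a : nat -> R) M x k :
  (k < M)%N -> 1 + a k * x = 0 -> (linprod a M).[x] = 0.
Proof.
move=> kM a0; rewrite /linprod horner_prod (bigD1 (Ordinal kM))//=.
by rewrite !hornerE a0 mul0r.
Qed.

(** The zeros of [sin((2M+1)t)] in the open interval from 0 to [pi/2], for [k < M]. *)
Definition node_angle (R : realType) (M k : nat) : R :=
  k.+1%:R * pi / odd_of R M.

Lemma node_angle_itv (R : realType) M k : (k < M)%N ->
  0 < node_angle R M k < pi / 2.
Proof.
move=> kM; have d0 := odd_of_gt0 R M; have p0 := pi_gt0 R.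
apply/andP; split; first by rewrite /node_angle !mulr_gt0 ?ltr0n ?invr_gt0.
rewrite /node_angle ltr_pdivrMr// mulrC -mulrA ltr_pM2l//.
have : k.+1%:R <= M%:R :> R by rewrite ler_nat.
by rewrite /odd_of; lra.
Qed.

Lemma sin_node_gt0 (R : realType) M k : (k < M)%N -> 0 < sin (node_angle R M k).
Proof. by move=> kM; apply: sin_gt0_pihalf; exact: node_angle_itv. Qed.

Lemma sin_node_inj (R : realType) M :
  {in gtn M &, injective (fun k => - sin (node_angle R M k) ^+ 2)}.
Proof.
move=> i j /[!inE] iM jM /oppr_inj /eqP.
rewrite eqrXn2 ?ltW ?sin_node_gt0// => /eqP /sin_inj.
have I k : (k < M)%N -> node_angle R M k \in `[- (pi / 2), pi / 2].
  move=> /(node_angle_itv R)/andP[? ?].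
  by rewrite in_itv/=; apply/andP; split; lra.
move=> /(_ (I _ iM) (I _ jM)); rewrite /node_angle => /mulIf.
rewrite invr_eq0 => /(_ (lt0r_neq0 (odd_of_gt0 _ _))) /mulIf.
by move=> /(_ (lt0r_neq0 (pi_gt0 _))) /eqP; rewrite eqr_nat => /eqP [].
Qed.

(** Both polynomials have degree at most [M] and vanish at the [M] values [- sin^2] of the node
    angles; the factor [2M+1] equates their constant terms. *)
Lemma coef_linprod_sin (R : realType) M m :
  (linprod (fun k => sin (node_angle R M k) ^- 2) M)`_m =
  oddprod (odd_of R M) m / ((2 * m).+1)`!%:R.
Proof.
set a := fun k => _; have d0 := lt0r_neq0 (odd_of_gt0 R M).
suff : (odd_of R M)%:P * linprod a M - chebpoly R M = 0.
  move=> /polyP /(_ m); rewrite coefB coefCM coef_chebpoly coef0.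
  move=> /eqP; rewrite subr_eq0 => /eqP /(canRL (mulKf d0)) ->.
  by rewrite /chebcoef -!mulrA mulKf.
(* The root 0 of the difference encodes equality of constant terms. It brings the number of roots to
   [M+1], beyond the degree. *)
pose rs := 0 :: [seq - sin (node_angle R M k) ^+ 2 | k <- iota 0 M].
apply: (@roots_geq_poly_eq0 _ _ rs).
- apply/allP => x; rewrite inE => /orP[/eqP ->|/mapP[k]].
    rewrite /root !hornerE !horner_coef0 coef0_linprod coef_chebpoly.
    by rewrite /chebcoef /oddprod big_ord0 divr1 subrr.
  rewrite mem_iota add0n => /= kM ->; have s0 := lt0r_neq0 (sin_node_gt0 R kM).
  rewrite /root !hornerE (@horner_linprod0 _ _ _ _ k)//; last first.
    by rewrite /a mulrN mulVf ?subrr// expf_neq0.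
  have := sin_chebpoly (node_angle R M k) M.
  rewrite mulrC /node_angle divfK// sinpi_nat => /esym/eqP.
  by rewrite mulf_eq0 (negbTE s0)/= mulr0 sub0r oppr_eq0.
- rewrite /= map_inj_in_uniq ?iota_uniq ?andbT.
    apply/mapP => -[k]; rewrite mem_iota add0n => /= kM /esym/eqP.
    by rewrite oppr_eq0 expf_eq0/= (gt_eqF (sin_node_gt0 R kM)).
  by move=> i j /[!mem_iota] iM jM; apply: sin_node_inj.
- rewrite /= size_map size_iota (leq_trans (size_polyD _ _))// size_polyN.
  rewrite geq_max size_poly andbT mul_polyC (leq_trans (size_scale_leq _ _))//.
  exact: size_linprod.
Qed.

Lemma cvg_odd_ofV (R : realType) : (odd_of R n)^-1 @[n --> \oo] --> (0 : R).
Proof.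
apply: (@squeeze_cvgr _ _ _ _ (cst 0) harmonic);
  [|exact: cvg_cst|exact: cvg_harmonic].
near=> n; rewrite invr_ge0 ltW ?odd_of_gt0//= lef_pV2 ?posrE ?odd_of_gt0//.
by rewrite /odd_of -natr1; have : 0 <= n%:R :> R by []; lra.
Unshelve. all: by end_near. Qed.

Lemma cvg_oddprod (R : realType) m :
  oddprod (odd_of R n) m / odd_of R n ^+ (2 * m) @[n --> \oo] --> (1 : R).
Proof.
elim: m => [|m IH].
  under eq_fun do rewrite /oddprod big_ord0 mul1r expr0 invr1; exact: cvg_cst.
have -> : (fun n => oddprod (odd_of R n) m.+1 / odd_of R n ^+ (2 * m.+1)) =
    (fun n => oddprod (odd_of R n) m / odd_of R n ^+ (2 * m) *
      (1 - (m%:R *+ 2 + 1) ^+ 2 * ((odd_of R n)^-1 * (odd_of R n)^-1))).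
  apply/funext => n; rewrite oddprodS mulnS exprD.
  have n1 := lt0r_neq0 (odd_of_gt0 R n).
  have n2 : odd_of R n ^+ (2 * m) != 0 by rewrite expf_neq0.
  by field; rewrite n1 n2.
rewrite [X in _ --> X](_ : 1 = 1 * (1 - (m%:R *+ 2 + 1) ^+ 2 * (0 * 0)));
  last by ring.
apply: cvgM => //; apply: cvgB; first exact: cvg_cst.
by apply: cvgM; [exact: cvg_cst|apply: cvgM; exact: cvg_odd_ofV].
Qed.

(* Approximates [k.+1%:R ^- 2]. *)
Definition node (R : realType) (M k : nat) : R :=
  (pi / odd_of R M) ^+ 2 / sin (node_angle R M k) ^+ 2.

Lemma cvg_coef_linprod_node (R : realType) m :
  (linprod (node R n) n)`_m @[n --> \oo] --> pi ^+ (2 * m) / ((2 * m).+1)`!%:R.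
Proof.
have -> : (fun n => (linprod (node R n) n)`_m) =
  (fun n => pi ^+ (2 * m) / ((2 * m).+1)`!%:R *
     (oddprod (odd_of R n) m / odd_of R n ^+ (2 * m))).
  apply/funext => n; rewrite coef_linprodZ coef_linprod_sin -exprM expr_div_n.
  by rewrite -!mulrA; congr (_ * _); rewrite mulrCA mulrC -!mulrA mulrC -mulrA.
rewrite -[X in _ --> X]mulr1; apply: cvgM; [exact: cvg_cst|exact: cvg_oddprod].
Qed.

(** With [q = pi/(2M+1)] and [t = (k+1) q] this is [0 <= 1/sin^2 t - 1/t^2 <= 1] multiplied by
    [q^2]. The upper bound is [t cos t <= sin t] squared. *)
Lemma node_bounds (R : realType) M k : (k < M)%N ->
  0 <= (k.+1%:R ^- 2 : R) <= node R M k /\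
  node R M k - k.+1%:R ^- 2 <= (pi / odd_of R M) ^+ 2.
Proof.
move=> kM; have d0 := odd_of_gt0 R M; have p0 := pi_gt0 R.
have s0 := sin_node_gt0 R kM; have /andP[t0 t1] := node_angle_itv R kM.
have ss := sin_lt_id t0.
have sc : node_angle R M k * cos (node_angle R M k) <= sin (node_angle R M k).
  by apply: mul_cos_le_sin; apply/andP; split; lra.
have c0 : 0 < cos (node_angle R M k) by apply: cos_gt0_pihalf; apply/andP; split; lra.
have s2 := cos2Dsin2 (node_angle R M k).
have q0 : 0 < pi / odd_of R M by rewrite divr_gt0.
have k0 : 0 < k.+1%:R :> R by rewrite ltr0n.
have tE : node_angle R M k = k.+1%:R * (pi / odd_of R M) by rewrite mulrA.
rewrite /node; move: t0 s0 ss sc c0 s2 tE.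
move: (node_angle R M k) (sin _) (cos _) (pi / odd_of R M) q0 (k.+1%:R) k0.
move=> t s c q q0 x x0 t0 s0 ss sc c0 s2 tE.
have -> : x ^- 2 = q ^+ 2 / t ^+ 2.
  by rewrite tE; field; rewrite !lt0r_neq0.
have q2 : 0 < q ^+ 2 by rewrite exprn_gt0.
have sst : s ^+ 2 <= t ^+ 2 by rewrite lerXn2r// nnegrE ltW.
split.
  rewrite divr_ge0 ?sqr_ge0//= ler_pM2l// lef_pV2// posrE exprn_gt0//.
have -> : q ^+ 2 / s ^+ 2 - q ^+ 2 / t ^+ 2 =
   q ^+ 2 * ((t ^+ 2 - s ^+ 2) / (s ^+ 2 * t ^+ 2)).
  by field; rewrite !lt0r_neq0.
rewrite ler_piMr ?sqr_ge0// ler_pdivrMr ?mulr_gt0 ?exprn_gt0// mul1r.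
have tc : (t * c) ^+ 2 <= s ^+ 2 by rewrite lerXn2r// nnegrE ltW// mulr_gt0.
have c2 : c ^+ 2 = 1 - s ^+ 2 by rewrite -s2 addrK.
by move: tc; rewrite exprMn c2; lra.
Qed.

(** Euler's product for the sine, coefficient by coefficient; the limit is [zeta({2}^m)]. *)
Lemma cvg_coef_linprod_sqrV (R : realType) m :
  (linprod (fun k => k.+1%:R ^- 2 : R) n)`_m @[n --> \oo] -->
  (pi ^+ (2 * m) / ((2 * m).+1)`!%:R : R).
Proof.
case: m => [|m].
  under eq_fun do rewrite coef0_linprod.
  by rewrite expr0 divr1; exact: cvg_cst.
pose b (k : nat) : R := k.+1%:R ^- 2.
suff : (linprod b n)`_m.+1 @[n --> \oo] -->
    (pi ^+ (2 * m.+1) / ((2 * m.+1).+1)`!%:R : R) by [].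
have -> : (fun n => (linprod b n)`_m.+1) = (fun n => (linprod (node R n) n)`_m.+1 -
   ((linprod (node R n) n)`_m.+1 - (linprod b n)`_m.+1)).
  by apply/funext => n; rewrite opprB addrC subrK.
rewrite -[X in _ --> X]subr0; apply: cvgB; first exact: cvg_coef_linprod_node.
(* The [n] node errors total at most [n (pi/(2n+1))^2], which is below [pi (pi/(2n+1))]. *)
apply: (@squeeze_cvgr _ _ _ _ (cst 0)
  (fun n => pi * (pi * (odd_of R n)^-1) * (linprod (node R n) n)`_m));
  [|exact: cvg_cst|]; last first.
  rewrite -[X in _ --> X](mul0r (pi ^+ (2 * m) / ((2 * m).+1)`!%:R)).
  apply: cvgM; last exact: cvg_coef_linprod_node.
  rewrite -[X in _ --> X](mulr0 pi); apply: cvgM; first exact: cvg_cst.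
  rewrite -[X in _ --> X](mulr0 pi); apply: cvgM; first exact: cvg_cst.
  exact: cvg_odd_ofV.
near=> n; have nb k : (k < n)%N -> 0 <= b k <= node R n k.
  by move=> /(node_bounds R)[].
have /andP[-> /= /le_trans] := coef_linprod_diff m nb; apply.
have [p0 d0] : 0 < pi :> R /\ 0 < odd_of R n by rewrite pi_gt0 odd_of_gt0.
apply: ler_wpM2r.
  apply: coef_linprod_ge0 => k kn.
  by have /andP[b0 /(le_trans b0)] := nb _ kn.
apply: (@le_trans _ _ (\sum_(k < n) (pi / odd_of R n) ^+ 2)).
  by apply: ler_sum => k _; have [] := node_bounds R (ltn_ord k).
rewrite sumr_const card_ord -mulr_natr.
have -> : (pi / odd_of R n) ^+ 2 * n%:R =
    pi * (pi * (odd_of R n)^-1) * (n%:R / odd_of R n).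
  by field; rewrite lt0r_neq0.
apply: ler_piMr; first by rewrite !mulr_ge0 ?invr_ge0 ?ltW.
rewrite ler_pdivrMr// mul1r.
by rewrite /odd_of; have : 0 <= n%:R :> R by []; lra.
Unshelve. all: by end_near. Qed.

(** * Multiple zeta values as iterated sums *)

(** One inequality follows from the finite subsums; applying it to [c^-1] gives the other. *)
Lemma esumZl (R : realType) (T : choiceType) (I : set T) (a : T -> \bar R) (c : R) :
  0 < c -> (forall i, (0 <= a i)%E) ->
  (\esum_(i in I) (c%:E * a i) = c%:E * \esum_(i in I) a i)%E.
Proof.
have le_esumZl (b : T -> \bar R) (x : R) : 0 < x -> (forall i, (0 <= b i)%E) ->
    (\esum_(i in I) (x%:E * b i) <= x%:E * \esum_(i in I) b i)%E.
  move=> x0 b0; apply: ge_ereal_sup => _ [X XI <-].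
  rewrite -ge0_mule_fsumr// lee_pmul2l// ?lte_fin//.
  by apply: ereal_sup_ubound; exists X.
move=> c0 a0; apply/eqP; rewrite eq_le le_esumZl//=.
have := le_esumZl (fun i => c%:E * a i)%E c^-1; rewrite invr_gt0 => /(_ c0).
under eq_esum do rewrite muleA -EFinM mulVf ?mul1e ?gt_eqF//.
move=> H; rewrite -lee_pdivlMl// H// => i.
by rewrite mule_ge0// lee_fin ltW.
Qed.

Definition mzv_weight (R : realType) (s l : seq nat) : R :=
  \prod_(p <- zip l s) (p.1%:R ^+ p.2)^-1.

Lemma mzv_weight_ge0 (R : realType) s l : 0 <= mzv_weight R s l.
Proof. by apply: prodr_ge0 => p _; rewrite invr_ge0 exprn_ge0. Qed.

(** The possible tails after a head equal to [n+1]. *)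
Definition mzv_dom_le (k n : nat) : set (seq nat) :=
  [set l | mzv_dom k l /\ all (geq n) l].

Lemma mzv_domS k (j : nat) l : mzv_dom k.+1 (j.+1 :: l) <-> mzv_dom_le k j l.
Proof.
have gtn_trans : transitive gtn by move=> y x z /= xy yz; exact: ltn_trans yz xy.
rewrite /mzv_dom_le /mzv_dom /= (path_sortedE gtn_trans); split.
  by move=> [[->] /andP[aj sl] al].
by move=> [[-> sl al] aj]; split=> //; rewrite sl andbT.
Qed.

(** Splits off the largest index [j+1]. The set [B] restricts [j], so that one statement serves
    truncated sums ([B] is [I_n]) and full ones ([B] is everything). *)
Lemma esum_mzv_cons (R : realType) (B : set nat) k i s :
  (\esum_(l in mzv_dom k.+1 `&` [set l | B (head 0%N l).-1])
     (mzv_weight R (i :: s) l)%:E =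
   \esum_(j in B) ((j.+1%:R ^+ i)^-1%:E *
     \esum_(l in mzv_dom_le k j) (mzv_weight R s l)%:E))%E.
Proof.
under [RHS]eq_esum => j _.
  rewrite -esumZl ?invr_gt0 ?exprn_gt0// => [|l]; last first.
    by rewrite lee_fin mzv_weight_ge0.
  over.
rewrite esum_esum; last first.
  by move=> j l _ _; rewrite mule_ge0// lee_fin ?mzv_weight_ge0// invr_ge0 exprn_ge0.
rewrite (reindex_esum (B `*`` mzv_dom_le k) _ (fun p => p.1.+1 :: p.2)).
  by apply: eq_esum => -[j l] _ /=; rewrite -EFinM /mzv_weight /= big_cons.
split.
- by move=> [j l] /= [Bj /mzv_domS].
- by move=> [j l] [j' l'] _ _ /= [-> ->].
- move=> [|[|j] l] /= [dl Bl]; [by case: dl|by case: dl|].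
  by exists (j, l) => //=; split=> //; apply/mzv_domS.
Qed.

(** Sorts the monomials of [e_(m+1)] by their largest index, which matches the recursion of the
    nested sums. *)
Lemma coef_linprodS_sum (R : comNzRingType) (a : nat -> R) n m :
  (linprod a n)`_m.+1 = \sum_(j < n) a j * (linprod a j)`_m.
Proof.
elim: n => [|n IH]; first by rewrite coef_linprod0 big_ord0.
by rewrite coef_linprodS IH big_ord_recr.
Qed.

Lemma esum_mzv_dom_le (R : realType) N n :
  (\esum_(l in mzv_dom_le N n) (mzv_weight R (nseq N 2%N) l)%:E)%E =
  ((linprod (fun k => k.+1%:R ^- 2 : R) n)`_N)%:E.
Proof.
elim: N n => [|N IH] n.
  have -> : mzv_dom_le 0 n = [set [::]].
    by apply/seteqP; split=> [l [[/size0nil]]|_ ->].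
  by rewrite esum_set1 ?lee_fin ?mzv_weight_ge0// /mzv_weight/= big_nil coef0_linprod.
(* In a decreasing sequence, bounding the head bounds every entry. *)
have -> : mzv_dom_le N.+1 n = mzv_dom N.+1 `&` [set l | `I_n (head 0%N l).-1].
  apply/seteqP; split=> -[|[|j] l] [dl] /=; try by case: dl.
    by move=> /andP[].
  move=> jn; split=> //=; rewrite jn /=; move/mzv_domS: dl => [_].
  by apply: sub_all => x /= xj; exact/ltnW/(leq_ltn_trans xj).
rewrite esum_mzv_cons coef_linprodS_sum.
under eq_esum do rewrite IH -EFinM.
rewrite esum_fset//; last first.
  move=> j _; rewrite lee_fin mulr_ge0 ?invr_ge0 ?exprn_ge0//.
  by apply: coef_linprod_ge0 => k _; rewrite invr_ge0 exprn_ge0.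
by rewrite -fsbig_ord sumEFin.
Qed.

Lemma esum_cvg (R : realType) (f : nat -> R) (x : R) : (forall n, 0 <= f n) ->
  \sum_(k < n) f k @[n --> \oo] --> x ->
  (\esum_(k in [set: nat]) (f k)%:E)%E = x%:E.
Proof.
move=> f0 fx; rewrite -nneseries_esumT => [|n]; last by rewrite lee_fin.
apply/cvg_lim => //; under eq_fun do rewrite sumEFin big_mkord.
by apply/cvg_EFin => //; exact: nearW.
Qed.

Lemma mzv_cvg (R : realType) i N (x : R) :
  \sum_(k < n) (k.+1%:R ^+ i)^-1 * (linprod (fun k => k.+1%:R ^- 2) k)`_N
    @[n --> \oo] --> x ->
  mzv R (i :: nseq N 2%N) = x%:E.
Proof.
pose f (k : nat) : R :=
  (k.+1%:R ^+ i)^-1 * (linprod (fun k => k.+1%:R ^- 2) k)`_N.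
move=> fx; rewrite -(@esum_cvg R f x _ fx) => [|n]; last first.
  rewrite mulr_ge0 ?invr_ge0 ?exprn_ge0//.
  by apply: coef_linprod_ge0 => k _; rewrite invr_ge0 exprn_ge0.
rewrite /mzv /= size_nseq.
have -> : mzv_dom N.+1 = mzv_dom N.+1 `&` [set l | setT (head 0%N l).-1].
  by rewrite (_ : [set l | _] = setT) ?setIT//; apply/seteqP.
rewrite esum_mzv_cons; apply: eq_esum => j _.
by rewrite esum_mzv_dom_le -EFinM.
Qed.

Lemma riemann_zeta_cvg (R : realType) i (x : R) :
  \sum_(k < n) (k.+1%:R ^+ i)^-1 @[n --> \oo] --> x -> riemann_zeta R i = x.
Proof.
move=> ix; rewrite /riemann_zeta (@mzv_cvg _ i 0 x)//.
by under eq_fun do under eq_bigr do rewrite coef0_linprod mulr1.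
Qed.

(** * Passage to the limit *)

(** [c_(k+1) = c_k (1 - (2k+1)/(M+k+1))], so each step loses at most [(2k+1)/(M+1)], and the first
    [k] odd numbers add up to [k^2]. *)
Lemma binratio_bounds (R : realFieldType) M k : (k <= M)%N ->
  0 <= binratio R M k <= 1 /\ 1 - binratio R M k <= k%:R ^+ 2 / M.+1%:R.
Proof.
elim: k => [|k IH] kM; first by rewrite binratio0 subrr expr0n mul0r ler01 lexx.
have [/andP[c0 c1] cb] := IH (ltnW kM).
have k0 : 0 <= k%:R :> R by [].
have kM' : k%:R + 1 <= M%:R :> R by rewrite natr1 ler_nat.
have := binratioS R M k; rewrite -[M.+1%:R]natr1 in cb *.
rewrite -[k.+1%:R]natr1; move: (binratio R M k.+1) (binratio R M k) c0 c1 cb.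
move: (M%:R) (k%:R) k0 kM' => x y y0 yx c' c c0 c1 cb E.
have n0 : 0 < x + y + 1 by lra.
have cE : c' = c - c * (y *+ 2 + 1) / (x + y + 1).
  by apply: (mulIf (lt0r_neq0 n0)); rewrite E; field; rewrite lt0r_neq0.
have y2 : 0 <= y *+ 2 + 1 by lra.
have d0 : 0 <= c * (y *+ 2 + 1) / (x + y + 1).
  by rewrite divr_ge0 ?mulr_ge0// ltW.
have d1 : c * (y *+ 2 + 1) / (x + y + 1) <= (y *+ 2 + 1) / (x + 1).
  rewrite ler_pM ?mulr_ge0 ?invr_ge0//; [exact: ltW|exact: ler_piMl|].
  by rewrite lef_pV2 ?posrE; lra.
split; last first.
  have -> : (y + 1) ^+ 2 / (x + 1) = y ^+ 2 / (x + 1) + (y *+ 2 + 1) / (x + 1).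
    by rewrite -mulrDl; congr (_ / _); ring.
  lra.
apply/andP; split; last by lra.
rewrite -(pmulr_lge0 _ n0) E mulr_ge0//; lra.
Qed.

Lemma harmdiff_bounds (R : realFieldType) M k :
  0 <= harmdiff R M k <= k%:R / M.+1%:R.
Proof.
have M0 : 0 <= M%:R :> R by [].
apply/andP; split.
  by apply: sumr_ge0 => i _; rewrite invr_ge0 !addr_ge0.
rewrite mulr_natl -[X in _ *+ X]card_ord -sumr_const; apply: ler_sum => i _.
have i0 : 0 <= i%:R :> R by [].
by rewrite -[M.+1%:R]natr1 lef_pV2 ?posrE; lra.
Qed.

Definition alt_term (R : realFieldType) (s k : nat) : R :=
  (-1) ^+ k * k.+1%:R ^- s.

(** Write [x = k+1]. The bounds [h <= x/(M+1)] on [harmdiff] and [1 - c <= x^2/(M+1)] on [binratio]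
    make the error of each term at most [(j+2)/((M+1) x)]. *)
Lemma oddsum_dist (R : realFieldType) M j :
  `|oddsum R M j - j.+1%:R * \sum_(k < M) alt_term R (2 * j + 3) k| <=
  j.+2%:R * (M.+1%:R^-1 * \sum_(k < M) k.+1%:R^-1).
Proof.
rewrite /oddsum big_add1 /= big_mkord 2!big_distrr/= -sumrB big_distrr/=.
rewrite (le_trans (ler_norm_sum _ _ _))//; apply: ler_sum => -[k kM] _ /=.
have k0 : 0 < k.+1%:R :> R by rewrite ltr0n.
have L0 : 0 < M.+1%:R :> R by rewrite ltr0n.
have [/andP[c0 c1] cb] := binratio_bounds R kM.
have /andP[h0 hb] := harmdiff_bounds R M k.+1.
have sE : k.+1%:R ^- (2 * j + 3) = (k.+1%:R ^- 2) ^+ j * k.+1%:R ^- 3 :> R.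
  by rewrite exprD exprM invfM exprVn.
rewrite /alt_term /bsign {}sE.
have -> : (-1) ^+ k.+2 = (-1) ^+ k :> R by rewrite -addn2 exprD sqrrN expr1n mulr1.
have q1 : (k.+1%:R ^- 2) ^+ j <= 1 :> R.
  apply: exprn_ile1; first by rewrite invr_ge0 exprn_ge0.
  by rewrite invf_le1 ?exprn_gt0// exprn_ege1// ler1n.
have q0 : 0 <= (k.+1%:R ^- 2) ^+ j :> R by rewrite exprn_ge0// invr_ge0 exprn_ge0.
have j0 : 0 <= j.+1%:R :> R by [].
rewrite -[j.+2%:R]natr1.
move: (binratio _ _ _) (harmdiff _ _ _) c0 c1 cb h0 hb q0 q1.
set q := (_ ^- 2) ^+ j; move: q (j.+1%:R) j0 (M.+1%:R) L0 (k.+1%:R) k0.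
move=> q J J0 L L0 x x0 c h c0 c1 cb h0 hb q0 q1.
rewrite [X in `|X|](_ : _ =
   (-1) ^+ k * (q * (c * (h / x ^+ 2) - J * ((1 - c) / x ^+ 3)))); last by ring.
rewrite normrM normrX normrN1 expr1n mul1r normrM ger0_norm//.
apply: (le_trans (ler_piMl (normr_ge0 _) q1)).
rewrite (le_trans (ler_normB _ _))// [leRHS]mulrDl mul1r [leRHS]addrC.
rewrite lerD//; last first.
  rewrite ger0_norm; last by rewrite mulr_ge0// divr_ge0 ?subr_ge0// exprn_ge0// ltW.
  rewrite ler_wpM2l// ler_pdivrMr ?exprn_gt0// (le_trans cb)//.
  by rewrite le_eqVlt; apply/orP; left; apply/eqP; field; rewrite !lt0r_neq0.
rewrite ger0_norm; last by rewrite mulr_ge0// divr_ge0// exprn_ge0// ltW.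
apply: (@le_trans _ _ (h / x ^+ 2)).
  by rewrite ler_piMl// divr_ge0// exprn_ge0// ltW.
rewrite ler_pdivrMr ?exprn_gt0// (le_trans hb)//.
by rewrite le_eqVlt; apply/orP; left; apply/eqP; field; rewrite !lt0r_neq0.
Qed.

Lemma cvg_harmonic_mean (R : realType) :
  n.+1%:R^-1 * \sum_(k < n) k.+1%:R^-1 @[n --> \oo] --> (0 : R).
Proof.
apply: (@squeeze_cvgr _ _ _ _ (cst 0) (arithmetic_mean (@harmonic R)));
  [|exact: cvg_cst|exact: (cesaro (@cvg_harmonic R))].
(* One extra term turns the sum into a Cesaro mean of the harmonic sequence. *)
near=> n; rewrite mulr_ge0 ?sumr_ge0//= ler_wpM2l//.
by rewrite seriesEord /= big_ord_recr/= lerDl.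
Unshelve. all: by end_near. Qed.

Lemma cvg_oddsum (R : realType) j (x : R) :
  \sum_(k < n) alt_term R (2 * j + 3) k @[n --> \oo] --> x ->
  oddsum R n j @[n --> \oo] --> j.+1%:R * x.
Proof.
move=> ax.
have -> : (fun n => oddsum R n j) = (fun n => (oddsum R n j -
    j.+1%:R * \sum_(k < n) alt_term R (2 * j + 3) k) +
    j.+1%:R * \sum_(k < n) alt_term R (2 * j + 3) k).
  by apply/funext => n; rewrite subrK.
rewrite -[X in _ --> X]add0r; apply: cvgD; last first.
  by apply: cvgM; [exact: cvg_cst|exact: ax].
apply/norm_cvg0P.
apply: (@squeeze_cvgr _ _ _ _ (cst 0)
  (fun n => j.+2%:R * (n.+1%:R^-1 * \sum_(k < n) k.+1%:R^-1)));
  [|exact: cvg_cst|].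
  by apply: nearW => n; rewrite normr_ge0/=; exact: oddsum_dist.
rewrite -[X in _ --> X](mulr0 j.+2%:R).
by apply: cvgM; [exact: cvg_cst|exact: cvg_harmonic_mean].
Qed.

Lemma is_cvg_zeta (R : realType) s : (1 < s)%N ->
  cvgn (fun n => \sum_(k < n) (k.+1%:R ^+ s)^-1 : R).
Proof.
move=> s1; apply: nondecreasing_is_cvgn.
  apply/nondecreasing_seqP => n; rewrite big_ord_recr/= lerDl.
  by rewrite invr_ge0 exprn_ge0.
(* The sharper bound [2 - 1/(n+1)] is inductive because [1/(n+2)^2 <= 1/(n+1) - 1/(n+2)]. *)
exists 2 => _ [[|n] _ <-]; first by rewrite big_ord0.
apply: (@le_trans _ _ (2 - n.+1%:R^-1)); last by rewrite gerBl invr_ge0.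
elim: n => [|n IH].
  by rewrite big_ord_recr big_ord0/= expr1n invr1 add0r; lra.
rewrite big_ord_recr/= (le_trans (lerD IH (lexx _)))//.
have n0 : 0 <= n%:R :> R by [].
have le2 : (n.+2%:R ^+ s)^-1 <= n.+2%:R ^- 2 :> R.
  by rewrite lef_pV2 ?posrE ?exprn_gt0 ?ltr0n// ler_eXn2l ?ltr1n.
rewrite (le_trans (lerD (lexx _) le2))// -addrA lerD2l -subr_ge0.
rewrite -[n.+2%:R]natr1 -natr1 in le2 *.
have -> : - (n%:R + 1 + 1)^-1 - (- (n%:R + 1)^-1 + (n%:R + 1 + 1) ^- 2) =
    (n%:R + 1)^-1 * (n%:R + 1 + 1) ^- 2 :> R.
  have n1 : n%:R + 1 != 0 :> R by apply: lt0r_neq0; lra.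
  have n2 : n%:R + 1 + 1 != 0 :> R by apply: lt0r_neq0; lra.
  by field; rewrite n1 n2.
by rewrite mulr_ge0 ?invr_ge0 ?exprn_ge0 ?addr_ge0.
Qed.

Lemma sum_double (V : zmodType) (f : nat -> V) n :
  \sum_(k < n.*2) f k = \sum_(k < n) (f k.*2 + f k.*2.+1).
Proof.
elim: n => [|n IH]; first by rewrite !big_ord0.
by rewrite doubleS !big_ord_recr/= IH addrA.
Qed.

Lemma cvg_double (T : topologicalType) (u : nat -> T) (x : T) :
  u n @[n --> \oo] --> x -> u n.*2 @[n --> \oo] --> x.
Proof.
apply: cvg_comp; apply/cvgnyPge => A; near=> n.
rewrite -addnn; apply: leq_trans (leq_addr _ _); near: n; exact: nbhs_infty_ge.
Unshelve. all: by end_near. Qed.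

Lemma cvg_alt_term (R : realType) s : (1 < s)%N ->
  \sum_(k < n) alt_term R s k @[n --> \oo] --> dirichlet_eta R s.
Proof.
move=> s1; have zs := @is_cvg_zeta R s s1.
have rz : riemann_zeta R s = limn (fun n => \sum_(k < n) (k.+1%:R ^+ s)^-1 : R).
  exact: riemann_zeta_cvg.
have ac : cvgn (series (alt_term R s)).
  apply: normed_cvg.
  have -> : [normed series (alt_term R s)] =
      (fun n => \sum_(k < n) (k.+1%:R ^+ s)^-1 : R); last exact: zs.
  apply/funext => n; rewrite /= /series/= big_mkord; apply: eq_bigr => k _.
  by rewrite /alt_term normrM normrX normrN1 expr1n mul1r ger0_norm//
    invr_ge0 exprn_ge0.
have aE : series (alt_term R s) = (fun n => \sum_(k < n) alt_term R s k).
  by apply/funext => n; rewrite /series/= big_mkord.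
rewrite aE in ac.
suff : limn (fun n => \sum_(k < n) alt_term R s k) = dirichlet_eta R s.
  by move=> <-.
have ac2 := cvg_double ac.
(* By absolute convergence the even partial sums suffice. There the alternating sum is the full sum
   minus twice its even-denominator terms, that is, [2/2^s] times the sum of half the length. *)
suff ae : \sum_(k < n.*2) alt_term R s k @[n --> \oo] --> dirichlet_eta R s.
  by rewrite -(cvg_lim _ ac2)//; exact: cvg_lim.
have -> : (fun n => \sum_(k < n.*2) alt_term R s k) =
  (fun n => \sum_(k < n.*2) (k.+1%:R ^+ s)^-1 -
     2 / 2 ^+ s * \sum_(k < n) (k.+1%:R ^+ s)^-1).
  apply/funext => n; rewrite (sum_double (alt_term R s)).
  rewrite (sum_double (fun k => k.+1%:R ^- s)) big_distrr/= -sumrB.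
  apply: eq_bigr => k _; rewrite /alt_term exprS -mul2n exprM sqrrN expr1n expr1n.
  rewrite (_ : (2 * k).+2 = 2 * k.+1)%N; last by rewrite mulnS.
  rewrite natrM exprMn invfM.
  by ring.
have -> : dirichlet_eta R s = riemann_zeta R s - 2 / 2 ^+ s * riemann_zeta R s.
  rewrite /dirichlet_eta mulrBl mul1r expfzDr ?pnatr_eq0// expr1z.
  by rewrite -exprnN.
rewrite rz; apply: cvgB; first exact: (cvg_double zs).
by apply: cvgM; [exact: cvg_cst|exact: zs].
Qed.

(** The finite identity is solved for its first sum, and each of the finitely many coefficients in
    the product passes to the limit. The sign [(-1)^N] converts coefficients of [P_n] into [e_N]. *)
Lemma cvg_sum_mzv (R : realType) (N : nat) :
  \sum_(k < n) (k.+1%:R ^+ 3)^-1 * (linprod (fun k => k.+1%:R ^- 2) k)`_N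
    @[n --> \oo] -->
  ((-1) ^+ N * (4 * (\sum_(m < N.+1)
     ((-1) ^+ m * (pi ^+ (2 * m) / ((2 * m).+1)`!%:R)) *
     ((N - m).+1%:R * dirichlet_eta R (2 * (N - m) + 3))) -
   2 * riemann_zeta R (2 * N + 3)) : R).
Proof.
pose b (k : nat) : R := k.+1%:R ^- 2.
have sb n m : (sinprod R n)`_m = (-1) ^+ m * (linprod b n)`_m.
  by rewrite -coef_linprodN.
pose z n : R := \sum_(k < n) (k.+1%:R ^+ (2 * N + 3))^-1.
have -> : (fun n => \sum_(k < n) (k.+1%:R ^+ 3)^-1 * (linprod b k)`_N) =
    (fun n => (-1) ^+ N * (4 * act (sinprod R n) (oddsum R n) N - 2 * z n)).
  apply/funext => n; rewrite act_sinprod_oddsum addrK big_distrr/=.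
  apply: eq_bigr => k _; rewrite sb mulrC !mulrA -expr2 sqrr_sign mul1r.
  by [].
apply: cvgM; first exact: cvg_cst.
apply: cvgB; (apply: cvgM; first exact: cvg_cst).
  apply: cvg_big => [|m _]; first exact: add_continuous.
  apply: cvgM.
    under eq_fun do rewrite sb.
    by apply: cvgM; [exact: cvg_cst|exact: cvg_coef_linprod_sqrV].
  by apply: cvg_oddsum; apply: cvg_alt_term; rewrite addn3.
have s1 : (1 < 2 * N + 3)%N by rewrite addn3.
have zc := @is_cvg_zeta R _ s1.
by rewrite (riemann_zeta_cvg zc).
Qed.

Theorem theorem3p3 (R : realType) (N : nat) :
  mzv R (3%N :: nseq N 2%N) =
  (2%:R *
   (\sum_(1 <= j < N.+1)
       (-1) ^+ (j + 1)%N * (2 * j)%N%:R * pi ^+ (2 * N + 2 - 2 * j)%N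
         / ((2 * N + 3 - 2 * j)`!)%N%:R * dirichlet_eta R (2 * j + 1)%N
    - (-1) ^+ N * (1 - (1 - 2%:R ^- (2 * N + 2)%N) * (2 * N + 2)%N%:R)
        * riemann_zeta R (2 * N + 3)%N))%:E.
Proof.
rewrite (mzv_cvg (@cvg_sum_mzv R N)); congr (_%:E).
(* Reversal [m = N - i] puts the eta value at [2i + 3], so [j = i + 1]. The last term [i = N]
   carries [eta(2N+3)] and joins the zeta term. *)
rewrite (reindex_inj rev_ord_inj) big_ord_recr/= subSS subnn expr0 subn0 divr1.
rewrite big_add1 /= big_mkord.
set S := \sum_(i < N) _; set S' := \sum_(i < N) _.
have SE : (-1) ^+ N * (2 * S) = S'.
  rewrite mulrA big_distrr/=; apply: eq_bigr => i _.
  have iN : (i < N)%N := ltn_ord i.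
  rewrite subSS subKn ?(ltnW iN)//.
  have -> : (2 * N + 2 - 2 * i.+1 = 2 * (N - i))%N by lia.
  have -> : (2 * N + 3 - 2 * i.+1 = (2 * (N - i)).+1)%N by lia.
  have -> : (2 * i.+1 + 1 = 2 * i + 3)%N by lia.
  (* The exponents [i + 2] and [2N - i] have the same parity. *)
  have -> : (-1) ^+ (i.+1 + 1) = (-1) ^+ N * (-1) ^+ (N - i) :> R.
    rewrite -exprD -[LHS]signr_odd -[RHS]signr_odd.
    by congr (_ ^+ nat_of_bool _); lia.
  by rewrite natrM; ring.
have -> : dirichlet_eta R (2 * N + 3) =
    (1 - 2 ^- (2 * N + 2)) * riemann_zeta R (2 * N + 3).
  rewrite /dirichlet_eta exprnN; congr ((1 - 2 ^ _) * _).
  by lia.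
rewrite -SE natrD natrM -[N.+1%:R]natr1 muln0 expr0.
by ring.
Qed.
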